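(* Let $M$ be a PTR-submanifold of a Sasakian manifold, tangent to $\xi$, whose chosen totally real distribution $\mathcal D^{\perp}$ is nonzero. Then $M$ cannot be totally umbilical. In particular, no proper PTR-submanifold with $\mathcal D^{\perp}\neq0$ is totally umbilical.
   Context: A Sasakian manifold $(\overline M^{2m+1},\phi,\xi,\eta,g)$ consists of a Riemannian metric $g$ with Levi-Civita connection $\widetilde\nabla$, a $(1,1)$-tensor field $\phi$, a vector field $\xi$ (the Reeb field) and a 1-form $\eta$ with $\phi^2X=-X+\eta(X)\xi$, $\eta(\xi)=1$, $\phi\xi=0$, $g(\phi X,\phi Y)=g(X,Y)-\eta(X)\eta(Y)$ and $(\widetilde\nabla_X\phi)Y=g(X,Y)\xi-\eta(Y)X$; in particular $\widetilde\nabla_X\xi=-\phi X$. Let $M$ be an immersed submanifold of $\overline M$ with $\xi\in\Gamma(TM)$, with second fundamental form $h$. A PTR (partially totally real) submanifold is such an $M$ with a chosen nonzero constant-rank distribution $\mathcal D^{\perp}\subset TM\cap\ker\eta$ satisfying $\phi\mathcal D^{\perp}\subset T^{\perp}M$. The ambiguous distribution $\widetilde{\mathcal D}$ is the orthogonal complement of $\mathcal D^{\perp}\oplus\langle\xi\rangle$ in $TM$. $M$ is totally umbilical if $h(U,V)=g(U,V)H$ for all tangent $U,V$, where $H$ is the mean curvature vector. On an open region where the geometric type of $\widetilde{\mathcal D}$ is constant, the PTR structure is called proper if $\widetilde{\mathcal D}$ is neither totally real ($\phi\widetilde{\mathcal D}\subset T^\perp M$) nor $\phi$-invariant ($\phi\widetilde{\mathcal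 D}=\widetilde{\mathcal D}$), and is neither slant nor pointwise slant. A distribution $D\subset TM\cap\ker\eta$ is pointwise slant if for each point $p$ the angle between $\phi X$ and $D_p$ is the same for all nonzero $X\in D_p$, and slant if this angle is moreover independent of $p$. *)

(* Defs.v *)
From HB Require Import structures.
From mathcomp Require Import all_boot all_order all_algebra.
From mathcomp Require Import all_classical all_reals all_analysis.
Import Order.TTheory GRing.Theory Num.Theory.
Import numFieldNormedType.Exports.

Set Implicit Arguments.
Unset Strict Implicit.
Unset Printing Implicit Defensive.

Local Open Scope classical_set_scope.
Local Open Scope ring_scope.

Section Smooth.
Context {R : realType}.
Implicit Types V W : normedModType R.

(* On an open set, [ck_at k f] at every point means that [f] is C^k there. *)
Fixpoint ck_at V W (k : nat) (f : V -> W) (x : V) : Prop :=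
  if k is k'.+1
  then differentiable f x /\ forall v, ck_at k' (fun y => 'D_v f y) x
  else {for x, continuous f}.

Definition ck_on V W k (U : set V) (f : V -> W) := forall x, U x -> ck_at k f x.

Definition smooth_on V W (U : set V) (f : V -> W) : Prop :=
  forall k, ck_on k U f.

Lemma near0_differentiable V W (d : V -> W) x :
  (\forall y \near x, d y = 0) -> differentiable d x.
Proof.
move=> d0.
have dx0 : d x = 0 by exact: nbhs_singleton d0.
have E : d \o shift x = cst (d x) + (\0 : V -> W) +o_ 0 id.
  apply/eqaddoP => e e0; rewrite dx0.
  have d0' : \forall h \near (0 : V), d (h + x) = 0.
    by move: d0; rewrite (near_shift 0 x) subr0.
  apply: filterS d0' => h dh.
  by rewrite !fctE /= /shift /= dh addr0 subrr normr0 mulr_ge0 // ltW.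
apply/diff_locallyP.
have c0 : continuous (\0 : {linear V -> W}) by move=> y; exact: cvg_cst.
by rewrite (diff_unique c0 E); split.
Unshelve. all: by end_near. Qed.

Lemma near_eq_differentiable V W (f g : V -> W) x :
  (\forall y \near x, f y = g y) -> differentiable f x -> differentiable g x.
Proof.
move=> fg df.
have -> : g = f + (g - f) by rewrite addrC subrK.
apply: differentiableD => //; apply: near0_differentiable.
by apply: filterS fg => y fgy; rewrite !fctE fgy subrr.
Qed.

Lemma near_eq_deriv V W (f g : V -> W) x v :
  (\forall y \near x, f y = g y) -> 'D_v f x = 'D_v g x.
Proof.
move=> fg; have [->|v0] := eqVneq v 0; first by rewrite !derive0.
exact: near_eq_derive.
Qed.

Lemma ck_at_near V W k (f g : V -> W) x :
  (\forall y \near x, f y = g y) -> ck_at k f x -> ck_at k g x.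
Proof.
elim: k f g x => [|k IH] f g x fg.
  have eqx : f x = g x by exact: nbhs_singleton fg.
  move=> fx; change (g y @[y --> x] --> g x); rewrite -eqx.
  by apply: cvg_trans fx; exact: near_eq_cvg.
move=> [df Df]; split; first exact: near_eq_differentiable df.
move=> v; apply: IH (Df v).
by near=> y; apply: near_eq_deriv; near: y; exact: near_join.
Unshelve. all: by end_near. Qed.

Lemma ck_on_eq V W k (U : set V) (f g : V -> W) :
  open U -> (forall x, U x -> f x = g x) -> ck_on k U f -> ck_on k U g.
Proof.
move=> oU fg ckf x Ux; apply: ck_at_near (ckf x Ux).
by near=> y; apply: fg; near: y; exact: open_nbhs_nbhs.
Unshelve. all: by end_near. Qed.

Lemma ck_onS V W k (U : set V) (f : V -> W) : ck_on k.+1 U f -> ck_on k U f.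
Proof.
move=> + x Ux => /(_ x Ux); elim: k f => [|k IH] f [df Df];
  first exact: differentiable_continuous.
by split=> // v; apply: IH; exact: Df.
Qed.

Lemma ck_on_diff V W k (U : set V) (f : V -> W) x :
  ck_on k.+1 U f -> U x -> differentiable f x.
Proof. by move=> /[apply] -[]. Qed.

Lemma ck_on_deriv V W k (U : set V) (f : V -> W) v :
  ck_on k.+1 U f -> ck_on k U (fun y => 'D_v f y).
Proof. by move=> H x Ux; have [_] := H x Ux; apply. Qed.

Lemma ck_on_cst V W k (U : set V) (c : W) : ck_on k U (fun=> c).
Proof.
elim: k c => [|k IH] c x Ux; first exact: cvg_cst.
split; first exact: differentiable_cst.
move=> v; have -> : (fun y => 'D_v (fun=> c) y) = fun=> (0 : W).
  by apply/funext => y; rewrite derive_cst.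
exact: IH.
Qed.

Lemma ck_onD V W k (U : set V) (f g : V -> W) : open U ->
  ck_on k U f -> ck_on k U g -> ck_on k U (fun x => f x + g x).
Proof.
move=> oU; elim: k f g => [|k IH] f g cf cg x Ux.
  by apply: continuousD; [exact: cf|exact: cg].
split; first by apply: differentiableD; [exact: ck_on_diff cf Ux|exact: ck_on_diff cg Ux].
move=> v; move: x Ux.
apply: (ck_on_eq oU _ (IH _ _ (ck_on_deriv v cf) (ck_on_deriv v cg))) => y Uy.
by rewrite -deriveD //; apply: diff_derivable;
  [exact: ck_on_diff cf Uy|exact: ck_on_diff cg Uy].
Qed.

Lemma ck_onM V k (U : set V) (f g : V -> R) : open U ->
  ck_on k U f -> ck_on k U g -> ck_on k U (fun x => f x * g x).
Proof.
move=> oU; elim: k f g => [|k IH] f g cf cg x Ux.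
  by apply: continuousM; [exact: cf|exact: cg].
split; first by apply: differentiableM; [exact: ck_on_diff cf Ux|exact: ck_on_diff cg Ux].
move=> v; move: x Ux.
have cfg := ck_onD oU (IH _ _ (ck_onS cf) (ck_on_deriv v cg))
                      (IH _ _ (ck_onS cg) (ck_on_deriv v cf)).
apply: (ck_on_eq oU _ cfg) => y Uy.
by rewrite deriveM //; apply: diff_derivable;
  [exact: ck_on_diff cf Uy|exact: ck_on_diff cg Uy].
Qed.

Lemma ck_on_sum V k (U : set V) n (f : 'I_n -> V -> R) : open U ->
  (forall i, ck_on k U (f i)) -> ck_on k U (fun x => \sum_(i < n) f i x).
Proof.
move=> oU; elim: n f => [|n IH] f cf.
  rewrite (_ : (fun x => _) = fun=> 0); first exact: ck_on_cst.
  by apply/funext => x; rewrite big_ord0.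
rewrite (_ : (fun x => _) = fun x => f ord0 x + \sum_(i < n) f (lift ord0 i) x).
  by apply: ck_onD => //; apply: IH.
by apply/funext => x; rewrite big_ord_recl.
Qed.

Lemma ck_on_coord V k n (U : set V) (F : V -> 'rV[R]_n) j : open U ->
  ck_on k U F -> ck_on k U (fun x => F x 0 j).
Proof.
move=> oU; elim: k F => [|k IH] F cF x Ux.
  apply: (@continuous_comp _ _ _ F (fun M : 'rV[R]_n => M 0 j)).
    exact: cF.
  exact: coord_continuous.
have dF y : U y -> differentiable F y by exact: ck_on_diff cF.
have dc y : differentiable (fun M : 'rV[R]_n => M 0 j : R) y.
  exact: differentiable_coord.
split; first by apply: (differentiable_comp (dF x Ux) (dc _)).
move=> v; move: x Ux.
apply: (ck_on_eq oU _ (IH _ (ck_on_deriv v cF))) => y Uy.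
pose L := fun M : 'rV[R]_n => M 0 j : R.
have Ll : linear L by move=> a u w; rewrite /L !mxE.
pose Lin := HB.pack_for {linear 'rV[R]_n -> R} L
  (GRing.isLinear.Build _ _ _ _ L Ll).
have cL : continuous (Lin : _ -> _) by exact: coord_continuous.
have dcF := differentiable_comp (dF y Uy) (dc (F y)).
rewrite (deriveE _ (dF y Uy)) (deriveE _ dcF) (diff_comp (dF y Uy) (dc (F y))) /=.
by rewrite (diff_lin _ cL : 'd L (F y) = L :> (_ -> _)).
Qed.

Lemma ck_on_comp m n k (U : set 'rV[R]_m) (V : set 'rV[R]_n)
    (F : 'rV[R]_m -> 'rV[R]_n) (g : 'rV[R]_n -> R) :
  open U -> (forall x, U x -> V (F x)) ->
  ck_on k U F -> ck_on k V g -> ck_on k U (g \o F).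
Proof.
move=> oU UV; elim: k F g UV => [|k IH] F g UV cF cg x Ux.
  by apply: continuous_comp; [exact: cF|exact/cg/UV].
have dF y : U y -> differentiable F y by exact: ck_on_diff cF.
have dg y : U y -> differentiable g (F y) by move/UV; exact: ck_on_diff cg.
split; first by apply: differentiable_comp; [exact: dF|exact: dg].
move=> v; move: x Ux.
pose h x := \sum_(j < n) ('D_v F x) 0 j * 'D_(delta_mx 0 j) g (F x).
apply: (@ck_on_eq _ _ k U h) => //.
  move=> x Ux; rewrite /h.
  rewrite (deriveE v (differentiable_comp (dF x Ux) (dg x Ux))).
  rewrite diff_comp; [|exact: dF|exact: dg] => /=.
  rewrite -(deriveE v (dF x Ux)) [in RHS](row_sum_delta ('D_v F x)) linear_sum.
  apply: eq_bigr => j _; rewrite linearZ /= -deriveE //; exact: dg.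
apply: ck_on_sum => // j; apply: ck_onM => //.
  by apply: ck_on_coord => //; exact: ck_on_deriv.
apply: (IH F (fun y => 'D_(delta_mx 0 j) g y)) => //.
  exact: ck_onS.
exact: ck_on_deriv.
Qed.

End Smooth.

Section Manifold.
Context {R : realType}.

(* Since [cdom] and its image are open, continuity at each of their points is
   continuity of the restrictions. *)
Record chart (n : nat) (T : topologicalType) := Chart {
  cdom : set T;
  cfun : T -> 'rV[R]_n;
  cinv : 'rV[R]_n -> T;
  cdom_open : open cdom;
  cimg_open : open (cfun @` cdom);
  cfunK : forall p, cdom p -> cinv (cfun p) = p;
  cfun_continuous : forall p, cdom p -> {for p, continuous cfun};
  cinv_continuous : forall x, (cfun @` cdom) x -> {for x, continuous cinv} }.

Record manifold (n : nat) := Manifold {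
  mspace :> topologicalType;
  atlas : set (chart n mspace);
  mspace_hausdorff : hausdorff_space mspace;
  mspace_second_countable : @second_countable mspace;
  mspace_inhabited : inhabited mspace;
  atlas_cover : forall p, exists2 c, atlas c & cdom c p;
  atlas_compatible : forall c c', atlas c -> atlas c' ->
    smooth_on (cfun c @` (cdom c `&` cdom c')) (cfun c' \o cinv c) }.

Definition smooth_fun n (M : manifold n) (f : M -> R) : Prop :=
  forall c, atlas c -> smooth_on (cfun c @` cdom c) (f \o cinv c).

Definition smooth_pred n (M : manifold n) : {pred M -> R} :=
  fun f => `[< smooth_fun f >].

Section SmoothFunctions.
Context (n : nat) (M : manifold n).

Lemma smooth_cst (a : R) : smooth_fun (fun _ : M => a).
Proof. by move=> c _ k; exact: ck_on_cst. Qed.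

Lemma smoothD (f g : M -> R) :
  smooth_fun f -> smooth_fun g -> smooth_fun (fun p => f p + g p).
Proof.
move=> sf sg c Ac k; apply: ck_onD; first exact: cimg_open.
- exact: sf.
- exact: sg.
Qed.

Lemma smoothM (f g : M -> R) :
  smooth_fun f -> smooth_fun g -> smooth_fun (fun p => f p * g p).
Proof.
move=> sf sg c Ac k; apply: ck_onM; first exact: cimg_open.
- exact: sf.
- exact: sg.
Qed.

Lemma smooth_subring : subring_closed (@smooth_pred n M).
Proof.
split=> [|f g /asboolP sf /asboolP sg|f g /asboolP sf /asboolP sg]; apply/asboolP.
- exact: smooth_cst.
- have := smoothD sf (smoothM (smooth_cst (-1)) sg).
  by congr smooth_fun; apply/funext => p; rewrite mulN1r.
- exact: smoothM.
Qed.

Lemma smooth_scale : GRing.scaler_closed (@smooth_pred n M).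
Proof.
by move=> a f /asboolP sf; apply/asboolP; exact: smoothM (smooth_cst a) sf.
Qed.

HB.instance Definition _ :=
  GRing.isSubringClosed.Build _ (@smooth_pred n M) smooth_subring.
HB.instance Definition _ :=
  GRing.isScaleClosed.Build R _ (@smooth_pred n M) smooth_scale.

Record smfun := SmFun { smval :> M -> R; smvalP : smval \in @smooth_pred n M }.
HB.instance Definition _ := [isSub for smval].
HB.instance Definition _ := [Choice of smfun by <:].
HB.instance Definition _ :=
  GRing.SubChoice_isSubComPzRing.Build _ _ smfun (subringClosedP _).
HB.instance Definition _ := [SubZmodule_isSubLmodule of smfun by <:].

Definition mk_smfun (f : M -> R) (sf : smooth_fun f) : smfun :=
  SmFun (introT (asboolP _) sf).

(* Tangent vectors are derivations of the algebra of global smooth functions;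
   on a Hausdorff second countable manifold these are the derivations on germs. *)
Definition derivation_at (p : M) : {pred smfun -> R} := fun v =>
  `[< scalar v /\ forall f g : smfun, v (f * g) = v f * g p + f p * v g >].

Lemma derivation_at_submod p : submod_closed (derivation_at p).
Proof.
split=> [|a u v /asboolP[ul uM] /asboolP[vl vM]]; apply/asboolP.
  split=> [a f g|f g].
    by change (0 = a * 0 + 0 :> R); rewrite mulr0 addr0.
  by change (0 = 0 * g p + f p * 0 :> R); rewrite mulr0 mul0r addr0.
split=> [b f g|f g].
  change (a * u (b *: f + g) + v (b *: f + g) =
    b * (a * u f + v f) + (a * u g + v g)).
  by rewrite ul vl !mulrDr addrACA !mulrA [a * b]mulrC.
change (a * u (f * g) + v (f * g) =
  (a * u f + v f) * g p + f p * (a * u g + v g)).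
by rewrite uM vM !mulrDr mulrDl addrACA !mulrA [f p * a]mulrC.
Qed.

HB.instance Definition _ p :=
  GRing.isSubmodClosed.Build R _ (derivation_at p) (derivation_at_submod p).

Record tangent (p : M) := Tangent {
  tval :> smfun -> R;
  tvalP : tval \in derivation_at p }.
HB.instance Definition _ p := [isSub for @tval p].
HB.instance Definition _ p := [Choice of tangent p by <:].
HB.instance Definition _ p := [SubChoice_isSubLmodule of tangent p by <:].

Record vfield := VField {
  vf :> forall p, tangent p;
  vf_smooth : forall f : smfun, smooth_fun (fun p => vf p f) }.

Definition vf_app (X : vfield) (f : smfun) : smfun := mk_smfun (vf_smooth X f).

Lemma vf_add_smooth (X Y : vfield) (f : smfun) :
  smooth_fun (fun p => (X p + Y p) f).
Proof. exact: smoothD (vf_smooth X f) (vf_smooth Y f). Qed.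

Definition vf_add (X Y : vfield) : vfield := VField (vf_add_smooth X Y).

Lemma vf_scale_smooth (a : smfun) (X : vfield) (f : smfun) :
  smooth_fun (fun p => (a p *: X p) f).
Proof. by apply: smoothM (vf_smooth X f); exact/asboolP/smvalP. Qed.

Definition vf_scale (a : smfun) (X : vfield) : vfield :=
  VField (vf_scale_smooth a X).

(* Tensor fields are pointwise linear and smooth in the sense that they send
   smooth vector fields to smooth fields or functions. *)
Record one_form := OneForm {
  of_val :> forall p, tangent p -> R;
  of_scalar : forall p, scalar (@of_val p);
  of_smooth : forall X : vfield, smooth_fun (fun p => of_val (X p)) }.

Record endo_field := EndoField {
  ef_val :> forall p, tangent p -> tangent p;
  ef_linear : forall p, linear (@ef_val p);
  ef_smooth : forall (X : vfield) (f : smfun),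
    smooth_fun (fun p => ef_val (X p) f) }.

Definition ef_app (A : endo_field) (X : vfield) : vfield :=
  VField (ef_smooth A X).

Record riemannian_metric := RiemannianMetric {
  met :> forall p, tangent p -> tangent p -> R;
  met_scalar : forall p (u : tangent p), scalar (met u);
  met_sym : forall p (u v : tangent p), met u v = met v u;
  met_pos : forall p (u : tangent p), u != 0 -> 0 < met u u;
  met_smooth : forall X Y : vfield, smooth_fun (fun p => met (X p) (Y p)) }.

Definition met_app (g : riemannian_metric) (X Y : vfield) : smfun :=
  mk_smfun (met_smooth g X Y).

(* [nabla u X] is the derivative of the field [X] along the single vector [u];
   letting [u] be a vector expresses that it is tensorial in that argument. *)
Record connection := Connection {
  nabla :> forall p, tangent p -> vfield -> tangent p;
  nabla_linear : forall p (X : vfield), linear (fun u : tangent p => nabla u X);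
  nablaD : forall p (u : tangent p) (X Y : vfield),
    nabla u (vf_add X Y) = nabla u X + nabla u Y;
  nabla_leibniz : forall p (u : tangent p) (a : smfun) (X : vfield),
    nabla u (vf_scale a X) = u a *: X p + a p *: nabla u X;
  nabla_smooth : forall (X Y : vfield) (f : smfun),
    smooth_fun (fun p => nabla (X p) Y f) }.

Definition torsion_free (D : connection) : Prop :=
  forall (X Y : vfield) p (f : smfun),
    (D p (X p) Y - D p (Y p) X) f = X p (vf_app Y f) - Y p (vf_app X f).

Definition metric_connection (g : riemannian_metric) (D : connection) : Prop :=
  forall p (u : tangent p) (X Y : vfield),
    u (met_app g X Y) = g p (D p u X) (Y p) + g p (X p) (D p u Y).

Definition levi_civita (g : riemannian_metric) (D : connection) : Prop :=
  torsion_free D /\ metric_connection g D.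

End SmoothFunctions.

Arguments smfun {n} M.
Arguments vfield {n} M.
Arguments one_form {n} M.
Arguments endo_field {n} M.
Arguments riemannian_metric {n} M.
Arguments connection {n} M.

Record sasakian (m : nat) := Sasakian {
  sman :> manifold m.*2.+1;
  smet : riemannian_metric sman;
  snabla : connection sman;
  sphi : endo_field sman;
  sxi : vfield sman;
  seta : one_form sman;
  snabla_levi_civita : levi_civita smet snabla;
  sphi_sphi : forall p (u : tangent p),
    sphi p (sphi p u) = - u + seta p u *: sxi p;
  seta_xi : forall p, seta p (sxi p) = 1;
  sphi_xi : forall p, sphi p (sxi p) = 0;
  smet_phi : forall p (u v : tangent p),
    smet p (sphi p u) (sphi p v) = smet p u v - seta p u * seta p v;
  snabla_phi : forall p (u : tangent p) (Y : vfield sman),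
    snabla p u (ef_app sphi Y) - sphi p (snabla p u Y) =
    smet p u (Y p) *: sxi p - seta p (Y p) *: u }.

Section Maps.
Context (n d : nat) (M : manifold n) (N : manifold d).

Record smap := SMap {
  smap_val :> M -> N;
  smap_continuous : continuous smap_val;
  smap_smooth : forall c c', atlas c -> atlas c' ->
    smooth_on (cfun c @` (cdom c `&` smap_val @^-1` cdom c'))
              (cfun c' \o smap_val \o cinv c) }.

Lemma smap_dom_open (F : smap) (c : chart n M) (c' : chart d N) :
  open (cfun c @` (cdom c `&` F @^-1` cdom c')).
Proof.
rewrite openE => _ [p [cp c'p] <-]; rewrite /interior.
have ip : (cfun c @` cdom c) (cfun c p) by exists p.
have cF : {for cfun c p, continuous (F \o cinv c)}.
  by apply: continuous_comp; [exact: cinv_continuous|exact: smap_continuous].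
have near1 : \forall x \near cfun c p, (cfun c @` cdom c) x.
  by apply: open_nbhs_nbhs; split=> //; exact: cimg_open.
have near2 : \forall x \near cfun c p, cdom c' (F (cinv c x)).
  apply: cF; rewrite /= cfunK//.
  by apply: open_nbhs_nbhs; split=> //; exact: cdom_open.
apply: filterS2 near1 near2 => _ [q cq <-]; rewrite cfunK// => c'q.
by exists q.
Qed.

Lemma pullback_smooth (F : smap) (f : smfun N) : smooth_fun (f \o F).
Proof.
move=> c Ac k _ [p cp <-].
have [c' Ac' c'p] := atlas_cover (F p).
have /asboolP sf := smvalP f.
pose U := cfun c @` (cdom c `&` F @^-1` cdom c').
have oU : open U by exact: smap_dom_open.
have Up : U (cfun c p) by exists p.
have ckU : ck_on k U ((f \o cinv c') \o (cfun c' \o F \o cinv c)).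
  apply: (@ck_on_comp _ _ _ _ U (cfun c' @` cdom c')) => //.
  - by move=> _ [q [cq c'q] <-]; exists (F q); rewrite //= cfunK.
  - exact: smap_smooth.
  - exact: sf.
apply: (ck_on_eq oU _ ckU) Up => _ [q [cq c'q] <-].
by rewrite /= !cfunK.
Qed.

Definition pullback (F : smap) (f : smfun N) : smfun M :=
  mk_smfun (pullback_smooth F f).

Lemma dmap_derivation (F : smap) p (v : tangent p) :
  (fun f => v (pullback F f)) \in derivation_at (F p).
Proof.
have /asboolP[vl vM] := tvalP v; apply/asboolP; split=> [a f g|f g].
  by rewrite -vl; congr (v _); apply: val_inj.
rewrite -(vM (pullback F f) (pullback F g)); congr (v _).
exact: val_inj.
Qed.

Definition dmap (F : smap) p (v : tangent p) : tangent (F p) :=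
  Tangent (dmap_derivation F v).

Definition immersion (F : smap) : Prop :=
  forall p, injective (@dmap F p).
End Maps.

Definition lin_indep n (M : manifold n) (p : M) r (e : 'I_r -> tangent p) : Prop :=
  forall a : 'I_r -> R, \sum_i a i *: e i = 0 -> forall i, a i = 0.

Definition span_of n (M : manifold n) (p : M) r (e : 'I_r -> tangent p) :
  set (tangent p) := [set v | exists a : 'I_r -> R, v = \sum_i a i *: e i].

(* [D] is smooth of constant rank [r].  Frames are made of globally defined
   fields; since a local frame can be multiplied by a bump function, this is the
   same as having smooth local frames. *)
Definition distribution n (M : manifold n) (r : nat)
    (D : forall p : M, set (tangent p)) : Prop :=
  forall p : M, exists X : 'I_r -> vfield M, \forall q \near p,
    lin_indep (fun i => X i q) /\ D q = span_of (fun i => X i q).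

Section Submanifold.
Context (m n : nat) (S : sasakian m) (M : manifold n) (F : smap M S).
Implicit Types (p : M) (D E : forall p : M, set (tangent p)).
Implicit Types h : forall p : M, tangent p -> tangent p -> tangent (F p).

Local Notation g := (smet S _).
Local Notation phi := (sphi S _).
Local Notation xi := (sxi S).
Local Notation eta := (seta S _).
Local Notation dF := (dmap F).

Definition normal p (w : tangent (F p)) : Prop :=
  forall u : tangent p, g (dF u) w = 0.

Definition induced_met p (u v : tangent p) : R := g (dF u) (dF v).

Definition reeb_tangent : Prop :=
  exists X : vfield M, forall p, dF (X p) = xi (F p).

(* Gauss formula: [h u Y] is the normal part of the ambient derivative along [u]
   of any field [Y'] extending [Y] near [p].  As [F] is locally an embedding,
   every [Y] has such extensions, so this determines [h]. *)
Definition second_fundamental_form h : Prop :=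
  forall p (u : tangent p) (Y : vfield M) (Y' : vfield S),
    (\forall q \near p, Y' (F q) = dF (Y q)) ->
    normal (h p u (Y p)) /\
    exists t : tangent p, snabla S _ (dF u) Y' = dF t + h p u (Y p).

Definition orthonormal p (e : 'I_n -> tangent p) : Prop :=
  forall i j, induced_met (e i) (e j) = (i == j)%:R.

Definition mean_curvature h (H : forall p, tangent (F p)) : Prop :=
  forall p (e : 'I_n -> tangent p), orthonormal e ->
    H p = n%:R^-1 *: \sum_i h p (e i) (e i).

Definition totally_umbilical h : Prop :=
  exists H, mean_curvature h H /\
    forall p (u v : tangent p), h p u v = induced_met u v *: H p.

(* Manifolds being nonempty, [0 < r] says that the distribution is nonzero. *)
Record ptr D : Prop := Ptr {
  ptr_immersion : immersion F;
  ptr_reeb_tangent : reeb_tangent;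
  ptr_distribution : exists2 r, (0 < r)%N & distribution r D;
  ptr_ker_eta : forall p (v : tangent p), D p v -> eta (dF v) = 0;
  ptr_totally_real : forall p (v : tangent p), D p v -> normal (phi (dF v)) }.

Definition ambiguous D p : set (tangent p) :=
  [set v | forall (w : tangent p) (a : R), D p w ->
    g (dF v) (dF w + a *: xi (F p)) = 0].

Definition totally_real_on (Omega : set M) E : Prop :=
  forall p, Omega p -> forall v, E p v -> normal (phi (dF v)).

Definition invariant_on (Omega : set M) E : Prop :=
  forall p, Omega p -> [set phi (dF v) | v in E p] = [set dF v | v in E p].

(* [t] is the angle between [w] and the subspace [A]: the orthogonal projection
   [y] of [w] onto [A] has length [cos t * |w|]. *)
Definition is_angle q (w : tangent q) (A : set (tangent q)) (t : R) : Prop :=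
  0 <= t <= pi / 2 /\
  exists y : tangent q, [/\ A y, forall z, A z -> g (w - y) z = 0 &
    Num.sqrt (g y y) = cos t * Num.sqrt (g w w)].

Definition slant_angle_at E p (t : R) : Prop :=
  forall v, E p v -> v != 0 -> is_angle (phi (dF v)) [set dF u | u in E p] t.

Definition pointwise_slant_on (Omega : set M) E : Prop :=
  forall p, Omega p -> exists t, slant_angle_at E p t.

Definition slant_on (Omega : set M) E : Prop :=
  exists t, forall p, Omega p -> slant_angle_at E p t.

(* Every nonempty open part of [Omega] is of the same type as [Omega]. *)
Definition constant_type (Omega : set M) E : Prop :=
  forall O : set M, open O -> O !=set0 -> O `<=` Omega ->
    [/\ totally_real_on O E <-> totally_real_on Omega E,
        invariant_on O E <-> invariant_on Omega E,
        slant_on O E <-> slant_on Omega E &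
        pointwise_slant_on O E <-> pointwise_slant_on Omega E].

Definition proper_on (Omega : set M) D : Prop :=
  let E := ambiguous D in
  [/\ open Omega, Omega !=set0, constant_type Omega E &
    [/\ ~ totally_real_on Omega E, ~ invariant_on Omega E,
        ~ slant_on Omega E & ~ pointwise_slant_on Omega E]].

End Submanifold.
End Manifold.

Arguments smfun {R n} M.
Arguments vfield {R n} M.
Arguments one_form {R n} M.
Arguments endo_field {R n} M.
Arguments riemannian_metric {R n} M.
Arguments connection {R n} M.
Arguments reeb_tangent {R m n S M} F.
Arguments second_fundamental_form {R m n S M} F h.
Arguments mean_curvature {R m n S M} F h H.
Arguments totally_umbilical {R m n S M} F h.
Arguments ptr {R m n S M} F D.
Arguments ambiguous {R m n S M} F D p.
Arguments proper_on {R m n S M} F Omega D.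

(* Main.v *)
Require Import Defs.
From mathcomp Require Import all_boot all_order all_algebra.
From mathcomp Require Import all_classical all_reals all_analysis.

(** The obstruction is visible on a single tangent vector.  In a Sasakian
    manifold the Reeb field satisfies [nabla_u xi = - phi u]
    ([nabla_reeb]).  When [xi] is tangent to the submanifold, the Gauss formula
    splits this derivative into a tangential part and [h(u, xi)].  If the
    submanifold is totally umbilical and [eta u = 0], then
    [h(u, xi) = g(u, xi) H = eta(u) H = 0], so [phi u] is tangent.  If moreover
    [phi u] is normal, as it is for [u] in the totally real distribution, then
    [phi u] is orthogonal to itself, hence [phi u = 0], and
    [u = eta(u) xi - phi (phi u) = 0] ([umbilical_totally_real_eq0]).  Thus the
    totally real distribution vanishes, whereas a distribution of positive rank
    on a (nonempty) manifold has a nonzero vector ([distribution_neq0]).  The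
    statement on proper structures is a special case. *)

Set Implicit Arguments.
Unset Strict Implicit.
Unset Printing Implicit Defensive.

Import Order.TTheory GRing.Theory Num.Theory.

Local Open Scope classical_set_scope.
Local Open Scope ring_scope.

Section Calculus.
Context {R : realType} {n : nat} {M : @manifold R n}.

Lemma vfield_eq (X Y : vfield M) : (forall p, X p = Y p) -> X = Y.
Proof.
case: X Y => [X sX] [Y sY] /= XY.
have {}XY : X = Y by apply: functional_extensionality_dep.
by case: _ / XY in sY *; congr VField; exact: Prop_irrelevance.
Qed.

(** A field vanishing identically satisfies [X + X = X], so additivity of the
    connection suffices. *)
Lemma nabla0 (D : connection M) p (u : tangent p) (X : vfield M) :
  (forall q, X q = 0) -> D p u X = 0.
Proof.
move=> X0; apply: (@addrI _ (D p u X)); rewrite addr0 -nablaD.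
by congr (D p u _); apply: vfield_eq => q /=; rewrite X0 addr0.
Qed.

Lemma tangent_cst (p : M) (u : tangent p) (f : smfun M) (c : R) :
  (forall q, f q = c) -> u f = 0.
Proof.
move=> fc; have /asboolP[ul uM] := tvalP u.
have u1 : u 1 = 0.
  have : u (1 * 1) = u 1 * 1 + 1 * u 1 := uM 1 1.
  by rewrite !mulr1 mul1r -[LHS]addr0 => /addrI.
have -> : f = (c - 1) *: (1 : smfun M) + (1 : smfun M).
  apply/val_inj/funext => q; rewrite /= fc.
  by change (c = (c - 1) * 1 + 1); rewrite mulr1 subrK.
by rewrite ul u1 mulr0 addr0.
Qed.

Lemma metDr (g : riemannian_metric M) p (u v w : tangent p) :
  g p u (v + w) = g p u v + g p u w.
Proof. by have := met_scalar g u 1 v w; rewrite scale1r mul1r. Qed.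

Lemma met0r (g : riemannian_metric M) p (u : tangent p) : g p u 0 = 0.
Proof. by apply: (@addrI _ (g p u 0)); rewrite -metDr !addr0. Qed.

Lemma metNr (g : riemannian_metric M) p (u v : tangent p) :
  g p u (- v) = - g p u v.
Proof. by apply: (@addrI _ (g p u v)); rewrite -metDr !subrr met0r. Qed.

Lemma met_eq0 (g : riemannian_metric M) p (u : tangent p) : g p u u = 0 -> u = 0.
Proof.
move=> guu; apply/eqP; case: (eqVneq u 0) => // /(met_pos g).
by rewrite guu ltxx.
Qed.

Lemma distribution_neq0 r (D : forall p : M, set (tangent p)) :
  (0 < r)%N -> Defs.distribution r D ->
  exists p, exists2 v : tangent p, D p v & v != 0.
Proof.
case: r => // r _ dD; have [p] := mspace_inhabited M.
have [X /nbhs_singleton[Xfree DE]] := dD p.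
have sumE : \sum_i (i == ord0)%:R *: X i p = X ord0 p.
  rewrite (bigD1 ord0) //= scale1r big1 ?addr0 // => i /negPf ->.
  by rewrite scale0r.
exists p, (X ord0 p); first by rewrite DE; exists (fun i => (i == ord0)%:R).
apply/eqP => X0; have /eqP := Xfree (fun i => (i == ord0)%:R) (etrans sumE X0) ord0.
by rewrite oner_eq0.
Qed.

Lemma dmap0 d (N : @manifold R d) (F : smap M N) p : dmap F (0 : tangent p) = 0.
Proof. exact: val_inj. Qed.

End Calculus.

Section Reeb.
Context {R : realType} {m : nat} (S : @sasakian R m).

Lemma eta_met_xi (p : sman S) (u : tangent p) :
  seta S p u = smet S p u (sxi S p).
Proof.
have := smet_phi u (sxi S p).
by rewrite sphi_xi met0r seta_xi mulr1 => /esym/eqP; rewrite subr_eq0 => /eqP.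
Qed.

(** Derivatives of a unit field are orthogonal to it. *)
Lemma eta_nabla_reeb (p : sman S) (u : tangent p) :
  seta S p (snabla S p u (sxi S)) = 0.
Proof.
rewrite eta_met_xi; have [_ /(_ p u (sxi S) (sxi S))] := snabla_levi_civita S.
rewrite (@tangent_cst _ _ _ _ _ _ 1); last first.
  by move=> q; rewrite /= -eta_met_xi seta_xi.
rewrite [in X in _ + X]met_sym => /esym/eqP.
by rewrite -mulr2n mulrn_eq0 /= => /eqP.
Qed.

(** Since [phi xi = 0], the formula for the derivative of [phi] in the direction
    of [xi] determines [phi (nabla_u xi)].  Applying [phi] once more determines
    [nabla_u xi] up to a multiple of [xi], which is zero because [xi] has unit
    length. *)
Lemma nabla_reeb (p : sman S) (u : tangent p) :
  snabla S p u (sxi S) = - sphi S p u.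
Proof.
have phi1 (a : R) (v w : tangent p) :
  sphi S p (a *: v + w) = a *: sphi S p v + sphi S p w by exact: ef_linear.
have := snabla_phi u (sxi S).
rewrite nabla0 ?sub0r; last by move=> q; exact: sphi_xi.
rewrite seta_xi scale1r -eta_met_xi => /(congr1 (fun v => sphi S p (- v))).
rewrite opprK sphi_sphi eta_nabla_reeb scale0r addr0 opprB addrC -scaleNr.
by rewrite phi1 sphi_xi scaler0 add0r => /eqP; rewrite eqr_oppLR => /eqP.
Qed.

End Reeb.

Section Umbilical.
Context {R : realType} {m n : nat} (S : @sasakian R m) (M : @manifold R n).
Context (F : smap M S).

(** Umbilicity makes [phi v = - nabla_v xi] tangent to the submanifold, so it is
    orthogonal to itself as soon as it is normal. *)
Lemma umbilical_totally_real_eq0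
    (h : forall p : M, tangent p -> tangent p -> tangent (F p)) p (v : tangent p) :
  reeb_tangent F -> second_fundamental_form F h -> totally_umbilical F h ->
  seta S _ (dmap F v) = 0 -> normal (sphi S _ (dmap F v)) -> dmap F v = 0.
Proof.
move=> [X FX] hF [H [_ hH]] eta0 phi_normal.
(* The Reeb field itself is the ambient extension of [X]. *)
have /(hF p v X)[_ [t]] : \forall q \near p, sxi S (F q) = dmap F (X q).
  by apply: nearW => q; rewrite FX.
rewrite nabla_reeb hH /induced_met FX -eta_met_xi eta0 scale0r addr0 => phit.
have phi0 : sphi S _ (dmap F v) = 0.
  apply: (@met_eq0 _ _ _ (smet S)); apply/eqP; rewrite -oppr_eq0 -metNr phit.
  by rewrite met_sym phi_normal.
have phi00 : sphi S (F p) 0 = 0.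
  by rewrite -[in LHS](sphi_xi (F p)) sphi_sphi seta_xi scale1r addNr.
have := sphi_sphi (dmap F v); rewrite phi0 phi00 eta0 scale0r addr0.
by move=> /esym/eqP; rewrite oppr_eq0 => /eqP.
Qed.

End Umbilical.

Unset Implicit Arguments.

Theorem theorem8p3 (R : realType) (m n : nat) (S : @sasakian R m)
    (M : @manifold R n) (F : smap M S)
    (Dperp : forall p : M, set (tangent p))
    (h : forall p : M, tangent p -> tangent p -> tangent (F p)) :
  ptr F Dperp -> second_fundamental_form F h ->
  ~ totally_umbilical F h /\
  (forall Omega : set M, proper_on F Omega Dperp -> ~ totally_umbilical F h).
Proof.
move=> [Fimm Freeb [r r0 distD] Deta Dreal] hF.
have not_umb : ~ totally_umbilical F h.
  move=> umb; have [p [v Dv /eqP]] := distribution_neq0 r0 distD; apply.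
  apply: (Fimm p); rewrite dmap0.
  by apply: (umbilical_totally_real_eq0 Freeb hF umb); [exact: Deta|exact: Dreal].
by split=> // Omega _.
Qed.
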